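(* Let $A=\mathbb{C}[x,y,z]$, let $s,t\in A\setminus\{0\}$ be coprime and equip $A$ with the Poisson bracket determined by $\{x,y\}=t s_z-s t_z$, $\{y,z\}=t s_x-s t_x$, $\{z,x\}=t s_y-s t_y$. For $(\lambda,\mu)\in\mathbb{P}^1(\mathbb{C})$ put $f_{\lambda,\mu}=\lambda s-\mu t$. Then the Poisson prime ideals of $A$ are exactly: $0$; the residually null Poisson prime ideals; and the height one prime ideals $uA$, where $u$ is an irreducible factor of $f_{\lambda,\mu}$ for some $(\lambda,\mu)\in\mathbb{P}^1(\mathbb{C})$ such that $f_{\lambda,\mu}$ is a non-zero non-unit.
   Context: Subscripts denote partial derivatives. A Poisson prime ideal is a prime ideal $P$ with $\{a,P\}\subseteq P$ for all $a\in A$. A Poisson ideal $I$ is residually null if the induced bracket on $A/I$ is zero, equivalently $I$ contains $\{x,y\},\{y,z\},\{z,x\}$; thus the residually null Poisson primes are exactly the prime ideals containing these three elements. *)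

(* Defs.v *)
From HB Require Import structures.
From mathcomp Require Import all_boot all_algebra.
From mathcomp Require Import mpoly.
From mathcomp.real_closed Require Import complex.
From mathcomp Require Import Rstruct.
Import GRing.Theory.
Local Open Scope ring_scope.

Definition C : fieldType := complex Rdefinitions.R.

Definition A : idomainType := {mpoly C[3]}.

Definition i0 : 'I_3 := @Ordinal 3 0 isT.
Definition i1 : 'I_3 := @Ordinal 3 1 isT.
Definition i2 : 'I_3 := @Ordinal 3 2 isT.

Definition dx (p : A) : A := mderiv i0 p.
Definition dy (p : A) : A := mderiv i1 p.
Definition dz (p : A) : A := mderiv i2 p.

(* The Poisson bracket on A determined by
   {x,y} = t s_z - s t_z, {y,z} = t s_x - s t_x, {z,x} = t s_y - s t_y,
   i.e. {a,b} = sum_{i,j} a_i b_j {x_i,x_j}. *)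
Definition bxy (s t : A) : A := t * dz s - s * dz t.
Definition byz (s t : A) : A := t * dx s - s * dx t.
Definition bzx (s t : A) : A := t * dy s - s * dy t.

Definition pbr (s t : A) (a b : A) : A :=
  (dx a * dy b - dy a * dx b) * bxy s t
+ (dy a * dz b - dz a * dy b) * byz s t
+ (dz a * dx b - dx a * dz b) * bzx s t.

Definition divides (d a : A) : Prop := exists q : A, a = d * q.

Definition irreducible_elt (u : A) : Prop :=
  u != 0 /\ u \isn't a GRing.unit /\
  (forall a b : A, u = a * b -> a \is a GRing.unit \/ b \is a GRing.unit).

Definition coprime_elts (s t : A) : Prop :=
  forall d : A, divides d s -> divides d t -> d \is a GRing.unit.

Definition is_ideal (I : A -> Prop) : Prop :=
  I 0 /\ (forall a b, I a -> I b -> I (a + b)) /\ (forall a b, I b -> I (a * b)).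

Definition is_prime_ideal (I : A -> Prop) : Prop :=
  is_ideal I /\ ~ I 1 /\ (forall a b, I (a * b) -> I a \/ I b).

Definition is_poisson_ideal (s t : A) (I : A -> Prop) : Prop :=
  is_ideal I /\ (forall a p, I p -> I (pbr s t a p)).

Definition is_poisson_prime (s t : A) (P : A -> Prop) : Prop :=
  is_prime_ideal P /\ is_poisson_ideal s t P.

(* residually null: the induced bracket on A/I is zero *)
Definition residually_null (s t : A) (I : A -> Prop) : Prop :=
  forall a b, I (pbr s t a b).

Definition zero_ideal (I : A -> Prop) : Prop := forall a, I a <-> a = 0.

Definition principal_ideal_of (u : A) (I : A -> Prop) : Prop :=
  forall a, I a <-> divides u a.

(* Main.v *)
Require Import Defs.
From HB Require Import structures.
From mathcomp Require Import all_boot all_algebra.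
From mathcomp Require Import mpoly.
From Stdlib Require Import Classical FunctionalExtensionality PropExtensionality.
From mathcomp.real_closed Require Import complex.
From mathcomp Require Import Rstruct ring.
Import GRing.Theory.
Local Open Scope ring_scope.

(* Let w = t grad s - s grad t, so that {x_i, p} are, up to sign, the components
   of w x grad p.  Let P be a nonzero Poisson prime that is not residually null,
   say w_k is not in P, and let R be the ring of polynomials not involving x_k.
   The derivations w_k d_j - w_j d_k preserve P, act on R as w_k d_j, and kill
   s/t.  So if sum_i g_i s^i t^(d-i) lies in P with g_i in R, it still does
   after differentiating all the g_i; repeating this, some nontrivial relation
   with constant g_i lies in P.  For d = 0 this gives P meet R = 0, whence by
   Gauss's lemma P is generated by any irreducible u in P.  For d large, the
   s^i t^(d-i) are linearly dependent modulo u over the fractions of R, so P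
   contains a binary form in s, t with constant coefficients; it splits into
   linear factors, one of which lies in P.  Conversely f = lam s - mu t divides
   every {a, f}, and hence each irreducible factor u of f divides {a, u}. *)

(** * Unique factorization in polynomial rings *)

Section Factorial.
Variable D : idomainType.

(** [dvd] and [irred] copy [divides] and [irreducible_elt] over an arbitrary domain; at [A] they are
    convertible to them. *)
Definition dvd (d a : D) : Prop := exists q, a = d * q.

Definition irred (u : D) : Prop :=
  u != 0 /\ u \isn't a GRing.unit /\
  (forall a b : D, u = a * b -> a \is a GRing.unit \/ b \is a GRing.unit).

Definition prime_elt (u : D) : Prop :=
  forall a b, dvd u (a * b) -> dvd u a \/ dvd u b.

(* An additive size vanishing exactly on units is a cheap substitute for
   atomicity. *)
Definition size_like (N : D -> nat) : Prop :=
  (forall a b, a * b != 0 -> N (a * b) = (N a + N b)%N) /\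
  (forall a, a != 0 -> (N a == 0%N) = (a \is a GRing.unit)).

Lemma irred_factor (N : D -> nat) (a : D) : size_like N ->
  a != 0 -> a \isn't a GRing.unit -> exists p b, irred p /\ a = p * b.
Proof.
move=> [NM NU]; have [n] := ubnP (N a); elim: n a => // n IHn a leNn a0 aU.
case: (classic (irred a)) => [irr_a|].
  by exists a, 1; rewrite mulr1.
move=> nirr; have [b [c [eqa bU cU]]] : exists b c,
    [/\ a = b * c, b \isn't a GRing.unit & c \isn't a GRing.unit].
  apply: NNPP => H; apply: nirr; do 2!split=> //.
  move=> b c eqa; case: (boolP (b \is a GRing.unit)) => bU; first by left.
  by right; apply: contraT => cU; case: H; exists b, c.
have [b0 c0] : b != 0 /\ c != 0.
  by move: a0; rewrite eqa mulf_eq0 negb_or => /andP.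
have [|p [d [irr_p eqb]]] := IHn b _ b0 bU.
  move: leNn; rewrite eqa NM -?eqa // ltnS => leNn; apply: leq_trans leNn.
  by rewrite -addn1 leq_add2l lt0n NU.
by exists p, (d * c); rewrite mulrA -eqb.
Qed.

End Factorial.

(** * Gauss's lemma: primality passes from R to R[X] *)

Section Gauss.
Variables (R : idomainType) (N : R -> nat).
Hypothesis NP : size_like R N.
Hypothesis irred_prime : forall p : R, irred R p -> prime_elt R p.

Let dvdP := dvd {poly R}.

Lemma unit_polyC (c : R) : (c%:P \is a GRing.unit) = (c \is a GRing.unit).
Proof.
by have [->|c0] := eqVneq c 0; rewrite ?rmorph0 ?unitr0 // poly_unitE coefC size_polyC c0.
Qed.

Lemma unit_poly_size (p : {poly R}) : p \is a GRing.unit -> size p = 1%N.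
Proof. by rewrite poly_unitE => /andP[/eqP]. Qed.

Lemma irred_polyC (c : R) : irred {poly R} c%:P -> irred R c.
Proof.
move=> [c0 [cU cI]]; split; first by rewrite polyC_eq0 in c0.
split; first by rewrite -unit_polyC.
move=> a b eqc; rewrite -!unit_polyC.
by apply: cI; rewrite eqc polyCM.
Qed.

(* Gauss's lemma: peel off leading terms. *)
Lemma prime_polyC (p : R) : prime_elt R p -> prime_elt {poly R} p%:P.
Proof.
move=> prp a b; have [n] := ubnP (size a + size b); elim: n a b => // n IHn a b.
rewrite ltnS => len [h eqh].
have [->|a0] := eqVneq a 0; first by left; exists 0; rewrite mulr0.
have [->|b0] := eqVneq b 0; first by right; exists 0; rewrite mulr0.
have step (q : {poly R}) : q != 0 -> dvd R p (lead_coef q) ->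
    exists q1 q2, q = q1 + p%:P * q2 /\ (size q1 < size q)%N.
  move=> q0 [c eqc]; set m := (size q).-1.
  have szq : size q = m.+1 by rewrite prednK // lt0n size_poly_eq0.
  exists (q - (p * c) *: 'X^m), (c *: 'X^m); split.
    by rewrite mul_polyC scalerA subrK.
  rewrite szq ltnS; apply/leq_sizeP => j; rewrite leq_eqVlt => /orP[/eqP<-|ltmj].
    by rewrite coefB coefZ coefXn eqxx mulr1 -eqc subrr.
  rewrite coefB coefZ coefXn gtn_eqF // mulr0 subr0 nth_default //.
  by rewrite szq.
have : dvd R p (lead_coef a * lead_coef b).
  exists (lead_coef h).
  by rewrite -lead_coefM eqh lead_coefM lead_coefC.
move=> /prp[] /step => [/(_ a0)|/(_ b0)] [q1 [q2 [eqq ltq]]].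
- have [||[h1 e]|] := IHn q1 b; [|exists (h - q2 * b)| |by right].
  + by apply: leq_trans len; rewrite ltn_add2r.
  + by rewrite mulrBr -eqh eqq; ring.
  + by left; exists (h1 + q2); rewrite eqq e mulrDr.
- have [|||[h1 e]] := IHn a q1; [|exists (h - q2 * a)|by left|].
  + by apply: leq_trans len; rewrite ltn_add2l.
  + by rewrite mulrBr -eqh eqq; ring.
  + by right; exists (h1 + q2); rewrite eqq e mulrDr.
Qed.

Lemma irred_polyC_prime (p : R) : irred R p -> prime_elt {poly R} p%:P.
Proof. by move/irred_prime/prime_polyC. Qed.

Lemma polyC_irred_neq0 (p : R) : irred R p -> p%:P != 0 :> {poly R}.
Proof. by case; rewrite polyC_eq0. Qed.

(** Clears the denominators of a factorization over the fraction field. Each irreducible factor of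
    [c] is prime in R[X], so it cancels against [q] or against [d]; those taken out of [d] are
    collected in [c']. *)
Lemma split_scalar (c : R) (u q d : {poly R}) : c != 0 ->
  c%:P * u = q * d ->
  exists q' d' c', [/\ u = q' * d', c' != 0 & d = c'%:P * d'].
Proof.
have [n] := ubnP (N c); elim: n c q d => // n IHn c q d leNn c0 eqc.
case: (boolP (c \is a GRing.unit)) => cU.
  exists (c^-1%:P * q), d, 1; rewrite oner_eq0 mul1r; split=> //.
  by rewrite -mulrA -eqc mulrA -polyCM mulVr // mul1r.
have [p [b [irr_p eqb]]] := irred_factor R N c NP c0 cU.
have p0 := polyC_irred_neq0 p irr_p.
have b0 : b != 0 by move: c0; rewrite eqb mulf_eq0 negb_or => /andP[].
have ltN : (N b < n)%N.
  have [NM NU] := NP.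
  apply: leq_trans (_ : N c <= n)%N => //.
  rewrite eqb NM -?eqb // -add1n leq_add2r lt0n NU.
    by have [_ []] := irr_p.
  by have [] := irr_p.
have [|[h e]|[h e]] := irred_polyC_prime p irr_p q d.
- by exists (b%:P * u); rewrite -eqc eqb polyCM mulrA.
- have [|q' [d' [c' H]]] := IHn b h d ltN b0; last by exists q', d', c'.
  by apply: (mulfI p0); rewrite !mulrA -e -polyCM -eqb.
- have [|q' [d' [c' [H1 H2 H3]]]] := IHn b q h ltN b0.
    by apply: (mulfI p0); rewrite mulrA -polyCM -eqb eqc e; ring.
  exists q', d', (p * c'); split=> //.
    by rewrite mulf_neq0 //; have [] := irr_p.
  by rewrite e H3 polyCM mulrA.
Qed.

Lemma irred_no_const (u : {poly R}) (p : R) : irred {poly R} u ->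
  (1 < size u)%N -> irred R p -> ~ dvdP p%:P u.
Proof.
move=> [_ [_ uI]] szu [p0 [pU _]] [h eqh].
have [] := uI _ _ eqh; first by rewrite unit_polyC (negPf pU).
move=> /unit_poly_size szh; move: szu; rewrite eqh mul_polyC.
by rewrite size_scale // szh.
Qed.

(** [split_scalar] gives f = h' u' with u = c' u'. As [u] is primitive, [c'] must be a unit, so [u]
    is associate to [u']. *)
Lemma dvd_cancel_scalar (c : R) (u f : {poly R}) : irred {poly R} u ->
  (1 < size u)%N -> c != 0 -> dvdP u (c%:P * f) -> dvdP u f.
Proof.
move=> irr_u szu c0 [h eqh].
have [|h' [u' [c' [eqf c'0 eqd]]]] := split_scalar c f h u c0.
  by rewrite eqh mulrC.
case: (boolP (c' \is a GRing.unit)) => c'U.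
  exists (c'^-1%:P * h'); rewrite eqf eqd.
  rewrite -(mulrC h') -mulrA [RHS]mulrA [c'%:P * _ * _]mulrAC mulrA.
  have -> : h' * u' = h' * u' * (c'^-1 * c')%:P by rewrite mulVr // mulr1.
  by rewrite polyCM; ring.
have [p [b [irr_p eqb]]] := irred_factor R N c' NP c'0 c'U.
case: (irred_no_const u p irr_u szu irr_p).
by exists (b%:P * u'); rewrite eqd eqb polyCM mulrA.
Qed.

(** Over the fraction field either [u] and [f] are coprime, which yields the identity once
    denominators are cleared, or their gcd has positive degree. In that case irreducibility makes
    [u] the gcd up to constants, and [dvd_cancel_scalar] removes the constant. *)
Lemma irred_dvd_or_bezout (u f : {poly R}) : irred {poly R} u ->
  (1 < size u)%N ->
  dvdP u f \/ exists a b c, c != 0 /\ a * u + b * f = c%:P.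
Proof.
move=> irr_u szu; have [/Pdiv.Idomain.Bezout_coprimepP[[a b] /= ab1]|ncop] :=
  boolP (coprimep u f); [right|left].
  move: ab1; rewrite -size_poly_eq1 => /size_poly1P[c c0 e].
  by exists a, b, c.
set d := gcdp u f; rewrite coprimep_def -/d in ncop.
have /Pdiv.Idomain.dvdpP[[c1 q1] /= c10 e1] : d %| u by rewrite dvdp_gcdl.
have /Pdiv.Idomain.dvdpP[[c2 q2] /= c20 e2] : d %| f by rewrite dvdp_gcdr.
rewrite -mul_polyC in e1; rewrite -mul_polyC in e2.
have [q [d' [c [equ c0 eqd]]]] := split_scalar c1 u q1 d c10 e1.
have [u0 [uU uI]] := irr_u.
have [qU|/unit_poly_size szd] := uI _ _ equ; last first.
  by move: ncop; rewrite eqd mul_polyC size_scale // szd.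
apply: (dvd_cancel_scalar c2) => //.
exists (q2 * c%:P * q^-1); rewrite e2 eqd equ.
have -> : q2 * (c%:P * d') = q2 * (c%:P * d') * (q * q^-1) by rewrite divrr ?mulr1.
by ring.
Qed.

(** When [u] has positive degree and does not divide [f], multiplying a u + b f = c by [g] shows
    that [u] divides c g, hence [g]. *)
Lemma irred_prime_poly (u : {poly R}) : irred {poly R} u -> prime_elt {poly R} u.
Proof.
move=> irr_u; case: (leqP (size u) 1) => szu f g.
  have equ := size1_polyC szu; rewrite equ in irr_u *.
  exact/irred_polyC_prime/irred_polyC.
move=> [h eqh].
have [|[a [b [c [c0 e]]]]] := irred_dvd_or_bezout u f irr_u szu; first by left.
right; apply: (dvd_cancel_scalar c) => //.
by exists (a * g + b * h); rewrite -e mulrDl -[b * f * g]mulrA eqh; ring.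
Qed.

End Gauss.

(** * Polynomials in n+1 variables as R[X], with X standing for a chosen variable *)

Section DistinguishedVariable.
Variables (F : fieldType) (n : nat) (k : 'I_n.+1).
Local Notation R := {mpoly F[n]}.
Local Notation B := {mpoly F[n.+1]}.

(** The index [k] is left arbitrary because it will be dictated by the component of [wronsk] that
    lies outside P. *)
Definition other_vars : R -> B :=
  mmap (@mpolyC n.+1 F) (fun j => 'X_(lift k j)).
HB.instance Definition _ := GRing.RMorphism.on other_vars.

Definition to_poly : B -> {poly R} :=
  mmap (@polyC R \o @mpolyC n F)
    (fun i => if unlift k i is Some j then ('X_j)%:P else 'X).
HB.instance Definition _ := GRing.RMorphism.on to_poly.

Definition of_poly (q : {poly R}) : B := (map_poly other_vars q).['X_k].

Fact of_poly_is_additive : additive of_poly.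
Proof. by move=> p q; rewrite /of_poly rmorphB hornerD hornerN. Qed.
Fact of_poly_is_multiplicative : multiplicative of_poly.
Proof.
by split=> [p q|]; rewrite /of_poly ?rmorphM ?hornerM // rmorph1 hornerC.
Qed.
HB.instance Definition _ :=
  GRing.isAdditive.Build {poly R} B of_poly of_poly_is_additive.
HB.instance Definition _ :=
  GRing.isMultiplicative.Build {poly R} B of_poly of_poly_is_multiplicative.

Lemma mpoly_rmorph_ext (m : nat) (T : pzRingType) (f g : {rmorphism {mpoly F[m]} -> T}) :
  (forall c, f c%:MP = g c%:MP) -> (forall i, f 'X_i = g 'X_i) -> f =1 g.
Proof.
move=> eqC eqX p; elim/mpolyind: p => [|c mm p _ _ IH]; first by rewrite !rmorph0.
rewrite !rmorphD /= IH; congr (_ + _); rewrite -mul_mpolyC !rmorphM /= eqC.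
congr (_ * _); rewrite mpolyXE_id !rmorph_prod /=; apply: eq_bigr => i _.
by rewrite !rmorphXn /= eqX.
Qed.

Lemma other_varsC c : other_vars c%:MP = c%:MP.
Proof. exact: mmapC. Qed.

Lemma other_varsX j : other_vars 'X_j = 'X_(lift k j).
Proof. by rewrite /other_vars mmapX mmap1U. Qed.

Lemma of_polyC r : of_poly r%:P = other_vars r.
Proof. by rewrite /of_poly map_polyC hornerC. Qed.

Lemma of_polyX : of_poly 'X = 'X_k.
Proof. by rewrite /of_poly map_polyX hornerX. Qed.

Lemma to_polyX i :
  to_poly 'X_i = if unlift k i is Some j then ('X_j)%:P else 'X.
Proof. by rewrite /to_poly mmapX mmap1U. Qed.

Lemma to_polyK : cancel to_poly of_poly.
Proof.
move=> p; pose f : {rmorphism B -> B} := of_poly \o to_poly.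
rewrite -[LHS]/(f p) (mpoly_rmorph_ext _ _ f idfun) // => [c|i] /=.
  by rewrite /to_poly mmapC /= of_polyC other_varsC.
by rewrite to_polyX; case: unliftP => [j|] ->; rewrite ?of_polyX // of_polyC other_varsX.
Qed.

Lemma to_poly_other_vars r : to_poly (other_vars r) = r%:P.
Proof.
pose f : {rmorphism R -> {poly R}} := to_poly \o other_vars.
rewrite -[LHS]/(f r) (mpoly_rmorph_ext _ _ f (@polyC R)) // => [c|i] /=.
  by rewrite other_varsC /to_poly mmapC.
by rewrite other_varsX to_polyX liftK.
Qed.

Lemma of_polyK : cancel of_poly to_poly.
Proof.
elim/poly_ind => [|p c IH]; first by rewrite !rmorph0.
rewrite !rmorphD !rmorphM /= of_polyX to_polyX IH of_polyC to_poly_other_vars.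
by rewrite unlift_none.
Qed.

Lemma to_poly_unit p : (to_poly p \is a GRing.unit) = (p \is a GRing.unit).
Proof.
apply/idP/idP => [pU|pU]; last exact: rmorph_unit.
by rewrite -[p]to_polyK; apply: rmorph_unit.
Qed.

Lemma to_poly_irred u : irred B u -> irred {poly R} (to_poly u).
Proof.
move=> [u0 [uU uI]]; split; first by rewrite -(can_eq of_polyK) to_polyK rmorph0.
split=> [|a b eqab]; first by rewrite to_poly_unit.
have [] := uI (of_poly a) (of_poly b).
- by rewrite -rmorphM -eqab /= to_polyK.
- by left; rewrite -[a]of_polyK to_poly_unit.
- by right; rewrite -[b]of_polyK to_poly_unit.
Qed.

Lemma to_poly_dvd u p : dvd {poly R} (to_poly u) (to_poly p) <-> dvd B u p.
Proof.
split=> [[q e]|[q ->]]; last by exists (to_poly q); rewrite rmorphM.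
by exists (of_poly q); apply: (can_inj to_polyK); rewrite rmorphM /= of_polyK.
Qed.

Lemma other_vars_inj : injective other_vars.
Proof. by move=> a b e; apply: polyC_inj; rewrite -!to_poly_other_vars e. Qed.

Lemma other_vars_eq0 r : (other_vars r == 0) = (r == 0).
Proof. by rewrite -(inj_eq other_vars_inj) rmorph0. Qed.

End DistinguishedVariable.

(** * Irreducible multivariate polynomials are prime *)

Section MpolyFactorial.
Variable F : fieldType.

(** The size here is the total degree, which is additive over a domain; [msize] is one more than
    it. *)
Lemma size_like_mpoly n : size_like {mpoly F[n]} (fun p => (msize p).-1).
Proof.
split=> [a b|a a0].
  rewrite mulf_eq0 negb_or => /andP[a0 b0]; rewrite msizeM //.
  by rewrite (mpolySpred _ a0) (mpolySpred _ b0) addnS.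
apply/idP/idP => [sza|aU].
  have /msize_poly1P[c c0 ->] : msize a == 1%N by rewrite (mpolySpred _ a0) eqSS.
  by apply: (rmorph_unit (@mpolyC n F)); rewrite unitfE.
have := congr1 (fun p => msize p) (divrr aU); have ia0 : a^-1 != 0 by rewrite invr_eq0.
rewrite msizeM // msize1 (mpolySpred _ a0) (mpolySpred _ ia0) addnS /=.
by case=> /eqP; rewrite addn_eq0 => /andP[].
Qed.

(** Induction on the number of variables, with Gauss's lemma as the inductive step. Without
    variables every non-zero element is a unit, so nothing is irreducible. *)
Theorem mpoly_irred_prime n (u : {mpoly F[n]}) :
  irred {mpoly F[n]} u -> prime_elt {mpoly F[n]} u.
Proof.
elim: n u => [|n IHn] u irr_u.
  have [u0 [/negP[]]] := irr_u; have eqc := nvar0_mpolyC_eq u erefl.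
  rewrite eqc; apply: (rmorph_unit (@mpolyC 0 F)); rewrite unitfE.
  by rewrite -(mpolyC_eq0 0) -eqc.
have := irred_prime_poly _ _ (size_like_mpoly n) IHn _ (to_poly_irred _ _ ord0 _ irr_u).
move=> pr_u a b /(to_poly_dvd _ _ ord0); rewrite rmorphM => /pr_u.
by case=> /to_poly_dvd; [left|right].
Qed.

End MpolyFactorial.

(** * Relations with constant coefficients *)

Section Derivations.
Variables (F : fieldType).
Hypothesis char0 : forall m, m.+1%:R != 0 :> F.

(** The twist by [f] lets the derivations take values in another ring; below, [f] is the embedding
    [other_vars]. *)
Lemma derivation_ext (m : nat) (T : comPzRingType) (f D1 D2 : {mpoly F[m]} -> T) :
  (forall a b, D1 (a + b) = D1 a + D1 b) ->
  (forall a b, D1 (a * b) = D1 a * f b + f a * D1 b) ->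
  (forall a b, D2 (a + b) = D2 a + D2 b) ->
  (forall a b, D2 (a * b) = D2 a * f b + f a * D2 b) ->
  (forall c, D1 c%:MP = D2 c%:MP) -> (forall i, D1 'X_i = D2 'X_i) -> D1 =1 D2.
Proof.
move=> A1 M1 A2 M2 eqC eqX; elim/mpolyind => [|c mm p _ _ IH].
  by rewrite -mpolyC0.
rewrite A1 A2 IH; congr (_ + _); rewrite -mul_mpolyC M1 M2 eqC; congr (_ + _ * _).
rewrite mpolyXE_id; apply: (big_ind (fun a => D1 a = D2 a)) => [|a b ea eb|i _].
- by rewrite -mpolyC1.
- by rewrite M1 M2 ea eb.
elim: (mm i) => [|e IHe]; first by rewrite expr0 -mpolyC1.
by rewrite exprS M1 M2 eqX IHe.
Qed.

Lemma mderiv_var_neq m (i j : 'I_m) : i != j -> mderiv i ('X_j : {mpoly F[m]}) = 0.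
Proof. by move=> ij; rewrite mderivX mnm1E eq_sym (negPf ij) scale0r. Qed.

Lemma mderiv_var m (i : 'I_m) : mderiv i ('X_i : {mpoly F[m]}) = 1.
Proof.
rewrite mderivX mnm1E eqxx scale1r; have -> : (U_(i) - U_(i) = 0 :> 'X_{1..m})%MM.
  by apply/mnmP => j; rewrite mnmBE subnn mnm0E.
exact: mpolyX0.
Qed.

Lemma mderiv_other_vars n (k : 'I_n.+1) (r : {mpoly F[n]}) :
  mderiv k (other_vars F n k r) = 0.
Proof.
apply: (derivation_ext _ _ (other_vars F n k) (fun r => mderiv k (other_vars F n k r))
         (fun=> 0)) => [a b|a b|a b|a b|c|i] /=.
- by rewrite rmorphD mderivD.
- by rewrite rmorphM mderivM.
- by rewrite addr0.
- by rewrite mul0r mulr0 addr0.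
- by rewrite other_varsC mderivC.
- by rewrite other_varsX mderiv_var_neq // neq_lift.
Qed.

Lemma mderiv_lift_other_vars n (k : 'I_n.+1) (j : 'I_n) (r : {mpoly F[n]}) :
  mderiv (lift k j) (other_vars F n k r) = other_vars F n k (mderiv j r).
Proof.
apply: (derivation_ext _ _ (other_vars F n k)
         (fun r => mderiv (lift k j) (other_vars F n k r))
         (fun r => other_vars F n k (mderiv j r))) => [a b|a b|a b|a b|c|i] /=.
- by rewrite rmorphD mderivD.
- by rewrite rmorphM mderivM.
- by rewrite mderivD rmorphD.
- by rewrite mderivM rmorphD !rmorphM.
- by rewrite other_varsC !mderivC rmorph0.
rewrite other_varsX; have [<-|ji] := eqVneq j i.
  by rewrite !mderiv_var rmorph1.
by rewrite !mderiv_var_neq ?rmorph0 // (inj_eq lift_inj).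
Qed.

(** If the exponent m_j is non-zero, the coefficient of the j-th derivative at m - U_j is m_j times
    that of [p] at m, and m_j is invertible in characteristic 0. *)
Lemma mderiv_eq0 n (p : {mpoly F[n]}) :
  (forall j, mderiv j p = 0) -> p = (p@_0)%:MP.
Proof.
move=> p0; apply/mpolyP => m; rewrite mcoeffC; have [->|m0] := eqVneq m 0%MM.
  by rewrite mulr1.
have [j mj] : exists j, m j != 0%N.
  apply/existsP; apply: contra_neqT m0; rewrite negb_exists => /forallP m0.
  by apply/mnmP => j; rewrite mnm0E; apply/eqP; have := m0 j; rewrite negbK.
have := mcoeff_mderiv j p (m - U_(j))%MM; rewrite p0 mcoeff0 submK; last first.
  by rewrite lep1mP.
by rewrite mulr0 => /esym/eqP; rewrite -mulr_natr mulf_eq0 (negPf (char0 _)) orbF => /eqP.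
Qed.

Lemma msize_mderiv n (j : 'I_n) (p : {mpoly F[n]}) :
  (msize (mderiv j p) <= (msize p).-1)%N.
Proof.
rewrite mmeasureE; apply/bigmax_leqP_seq => m; rewrite mcoeff_msupp mcoeff_mderiv.
move=> pm _; have : (m + U_(j))%MM \in msupp p.
  by rewrite mcoeff_msupp; apply: contraNneq pm => ->; rewrite mul0rn.
move=> /msize_mdeg_lt; rewrite mdegD mdeg1 addn1 => lt.
by rewrite -ltnS prednK //; apply: leq_trans lt.
Qed.

(** Induction on the largest size of an entry. Some partial derivative of the row is non-zero and
    has smaller entries, unless all of them vanish, in which case the row is already constant. *)
Lemma deriv_closed_const n d (Q : 'rV[{mpoly F[n]}]_d -> Prop) :
  (forall j g, Q g -> Q (map_mx (mderiv j) g)) ->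
  forall g, g != 0 -> Q g ->
  exists c : 'rV[F]_d, c != 0 /\ Q (map_mx (@mpolyC n F) c).
Proof.
move=> Qd g; have [N] := ubnP (\max_i msize (g ord0 i)).
elim: N g => // N IHN g ltN g0 Qg.
case: (classic (exists j, map_mx (mderiv j) g != 0)) => [[j gj0]|gconst].
  apply: (IHN (map_mx (mderiv j) g)) => //; last exact: Qd.
  have /rV0Pn[i gi0] := g0.
  have gt0 : (0 < \max_i msize (g ord0 i))%N.
    apply: leq_trans (leq_bigmax (F := fun i => msize (g ord0 i)) i).
    by rewrite lt0n msize_poly_eq0.
  rewrite -ltnS; apply: leq_ltn_trans ltN; rewrite -(prednK gt0) ltnS.
  apply/bigmax_leqP => l _; rewrite mxE; apply: leq_trans (msize_mderiv _ _ _) _.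
  by rewrite -!subn1 leq_sub2r // (leq_bigmax (F := fun i => msize (g ord0 i)) l).
have eqg : g = map_mx (@mpolyC n F) (map_mx (mcoeff 0%MM) g).
  apply/rowP => i; rewrite !mxE; apply: mderiv_eq0 => j.
  have : map_mx (mderiv j) g == 0.
    by apply: contraT => gj; case: gconst; exists j.
  by move/eqP/rowP/(_ i); rewrite !mxE.
exists (map_mx (mcoeff 0%MM) g); split; last by rewrite -eqg.
by apply: contra_neq g0 => g0; rewrite eqg g0 map_mx0.
Qed.

End Derivations.

(** * Binary forms in s and t *)

Section BinaryForms.
Variables (R : pzRingType) (B : comPzRingType) (h : R -> B).

(** The map [h] is a bare function, so that the same form serves coefficients in the field, in R, or
    embedded through several maps. *)
Definition bform d (g : 'rV[R]_d.+1) (s t : B) : B :=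
  \sum_(i < d.+1) h (g 0 i) * (s ^+ i * t ^+ (d - i)).

(** The hypothesis says D(s/t) = 0 without dividing. Since the monomial is (s/t)^i t^d, its
    logarithmic derivative is d D(t)/t, which does not depend on [i]. *)
Lemma derivation_monomial (D : B -> B) (s t : B) d i :
  (forall a b, D (a * b) = D a * b + a * D b) -> t * D s = s * D t ->
  (i <= d)%N ->
  t * D (s ^+ i * t ^+ (d - i)) = d%:R * D t * (s ^+ i * t ^+ (d - i)).
Proof.
move=> DM Dst lid.
have D1 : D 1 = 0.
  by have := DM 1 1; rewrite !mulr1 mul1r => /esym/eqP; rewrite -subr_eq0 addrK => /eqP.
have DX x e : t * D x = x * D t -> t * D (x ^+ e) = e%:R * D t * x ^+ e.
  move=> Dx; elim: e => [|e IHe]; first by rewrite D1; ring.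
  rewrite !exprS DM mulrDr [t * (x * _)]mulrCA IHe mulrA Dx -natr1; ring.
rewrite DM mulrDr mulrA [t * (_ * _)]mulrCA !DX //.
have -> : d%:R = i%:R + (d - i)%:R :> B by rewrite -natrD subnKC.
by ring.
Qed.

End BinaryForms.

(** * Prime ideals of an arbitrary domain *)

Definition ideal (D : idomainType) (I : D -> Prop) : Prop :=
  I 0 /\ (forall a b, I a -> I b -> I (a + b)) /\ (forall a b, I b -> I (a * b)).

Definition prime_ideal (D : idomainType) (I : D -> Prop) : Prop :=
  ideal D I /\ ~ I 1 /\ (forall a b, I (a * b) -> I a \/ I b).

Section PrimeIdeals.
Variables (D : idomainType) (P : D -> Prop).
Hypothesis primeP : prime_ideal D P.

Lemma ideal0 : P 0. Proof. by case: primeP => [[]]. Qed.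
Lemma idealD a b : P a -> P b -> P (a + b).
Proof. by case: primeP => [[_ [H _]] _]; apply: H. Qed.
Lemma idealMr a b : P b -> P (a * b).
Proof. by case: primeP => [[_ [_ H]] _]; apply: H. Qed.
Lemma idealB a b : P a -> P b -> P (a - b).
Proof. by move=> Pa Pb; apply: idealD => //; rewrite -mulN1r; apply: idealMr. Qed.
Lemma primeM a b : P (a * b) -> P a \/ P b.
Proof. by case: primeP => [_ [_ H]]; apply: H. Qed.
Lemma prime1 : ~ P 1. Proof. by case: primeP => [_ []]. Qed.
Lemma prime_cancel a b : ~ P a -> P (a * b) -> P b.
Proof. by move=> na /primeM[]. Qed.
Lemma prime_unit a : a \is a GRing.unit -> ~ P a.
Proof. by move=> aU Pa; apply: prime1; rewrite -(mulVr aU); apply: idealMr. Qed.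
Lemma ideal_dvd a b : P a -> dvd D a b -> P b.
Proof. by move=> Pa [q ->]; rewrite mulrC; apply: idealMr. Qed.

Lemma irred_in_prime (N : D -> nat) (a : D) : size_like D N -> a != 0 -> P a ->
  exists u, irred D u /\ P u.
Proof.
move=> NP; have [n] := ubnP (N a); elim: n a => // n IHn a leNn a0 Pa.
have aU : a \isn't a GRing.unit by apply/negP => /prime_unit.
have [p [b [irr_p eqa]]] := irred_factor D N a NP a0 aU.
have [b0 p0] : b != 0 /\ p != 0.
  by move: a0; rewrite eqa mulf_eq0 negb_or => /andP[].
have [Pp|Pb] : P p \/ P b by apply: primeM; rewrite -eqa.
  by exists p.
apply: (IHn b) => //; have [NM NU] := NP.
rewrite -ltnS; apply: leq_trans leNn; rewrite ltnS eqa NM -?eqa //.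
by rewrite -add1n leq_add2r lt0n NU //; have [_ []] := irr_p.
Qed.

(* Differentiating a relation sum_i g_i s^i t^(d-i) in P along D only
   differentiates the coefficients, because D kills s/t. *)
Lemma bform_deriv (R : pzRingType) (h : R -> D) (dR : R -> R) (dD : D -> D)
    (s t w : D) d (g : 'rV[R]_d.+1) :
  (forall a b, dD (a + b) = dD a + dD b) ->
  (forall a b, dD (a * b) = dD a * b + a * dD b) ->
  (forall r, dD (h r) = w * h (dR r)) ->
  t * dD s = s * dD t -> (forall a, P a -> P (dD a)) -> ~ P t -> ~ P w ->
  P (bform R D h d g s t) -> P (bform R D h d (map_mx dR g) s t).
Proof.
move=> dA dM dh dst dP nPt nPw Pg.
have dD0 : dD 0 = 0.
  by have := dA 0 0; rewrite addr0 => /esym/eqP; rewrite -subr_eq0 addrK => /eqP.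
apply: (prime_cancel (t * w)); first by move=> /primeM[].
(* The terms in which the monomials are differentiated add up to a multiple of the original form and
   cancel. *)
have -> : t * w * bform R D h d (map_mx dR g) s t =
    t * dD (bform R D h d g s t) - d%:R * dD t * bform R D h d g s t.
  rewrite /bform (big_morph dD dA dD0) !mulr_sumr -sumrB; apply: eq_bigr => i _.
  rewrite mxE dM mulrDr mulrA [t * (h _ * _)]mulrCA (derivation_monomial _ dD) //.
    by rewrite dh; ring.
  by rewrite -ltnS.
by apply: idealB; apply: idealMr => //; apply: dP.
Qed.

End PrimeIdeals.

(** * Algebraic relations between s and t, and their factorization *)

Section AlgebraicRelation.
Variable F : fieldType.

(** There are d+1 monomials of degree d = [size u], whereas remainders modulo [u] have fewer than d
    coefficients, so linear algebra gives a dependence. *)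
Lemma poly_relation (R : idomainType) (u s t : {poly R}) : u != 0 ->
  exists d (g : 'rV[R]_d.+1), g != 0 /\ dvd {poly R} u (bform R {poly R} (@polyC R) d g s t).
Proof.
move=> u0; set d := size u; pose p (i : 'I_d.+1) := s ^+ i * t ^+ (d - i).
pose M : 'M[R]_d.+1 := \matrix_(i, j) (p i %% u)`_j.
have szr i : (size (p i %% u)%R < d)%N by rewrite ltn_modpN0.
(* The last column of [M] is zero, as every remainder has size below [d]. *)
have /det0P[v v0 vM] : \det M == 0.
  rewrite (expand_det_col _ ord_max) big1 // => i _.
  by rewrite mxE nth_default ?mul0r //= ltnW.
(* Pseudo-division only divides the monomial times a power of the leading coefficient of [u]; that
   power is absorbed into [g]. *)
pose g := \row_i (v 0 i * lead_coef u ^+ scalp (p i) u).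
exists d, g; split.
  have /rV0Pn[i vi] := v0; apply/rV0Pn; exists i.
  by rewrite mxE mulf_neq0 // expf_neq0 // lead_coef_eq0.
exists (\sum_i (v 0 i)%:P * (p i %/ u)).
have -> : bform R {poly R} (@polyC R) d g s t =
    \sum_i ((v 0 i)%:P * ((p i %/ u) * u) + (v 0 i)%:P * (p i %% u)).
  apply: eq_bigr => i _; rewrite -/(p i) mxE polyCM -mulrA [_%:P * p i]mul_polyC.
  by rewrite Pdiv.Idomain.divp_eq mulrDr.
rewrite big_split /= [X in _ + X](_ : _ = 0).
  by rewrite addr0 mulr_sumr; apply: eq_bigr => i _; ring.
apply/polyP => j; rewrite coef0 coef_sum; case: (ltnP j d.+1) => ltj.
  have := congr1 (fun A : 'rV_d.+1 => A 0 (Ordinal ltj)) vM; rewrite !mxE => vMj.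
  by rewrite -[RHS]vMj; apply: eq_bigr => i _; rewrite coefCM mxE.
rewrite big1 // => i _; rewrite coefCM nth_default ?mulr0 //.
by apply: ltnW; apply: ltn_trans (szr i) _.
Qed.

Lemma mpoly_relation n (k : 'I_n.+1) (u s t : {mpoly F[n.+1]}) : u != 0 ->
  exists d (g : 'rV[{mpoly F[n]}]_d.+1), g != 0 /\
    dvd {mpoly F[n.+1]} u (bform _ _ (other_vars F n k) d g s t).
Proof.
move=> u0; have [|d [g [g0 dg]]] := poly_relation {mpoly F[n]} (to_poly F n k u)
  (to_poly F n k s) (to_poly F n k t).
  by rewrite -(can_eq (of_polyK F n k)) to_polyK rmorph0.
exists d, g; split=> //; apply/(to_poly_dvd F n k).
rewrite /bform rmorph_sum; congr (dvd _ _ _): dg; apply: eq_bigr => i _.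
by rewrite !rmorphM !rmorphXn /= to_poly_other_vars.
Qed.

Variables (n : nat) (P : {mpoly F[n]} -> Prop).
Hypothesis closedF : forall q : {poly F}, size q != 1%N -> exists x, root q x.
Hypothesis primeP : prime_ideal {mpoly F[n]} P.

(* Over an algebraically closed field binary forms split into linear factors. *)
Lemma bform_linear_factor (s t : {mpoly F[n]}) d (q : {poly F}) :
  q != 0 -> (size q <= d.+1)%N ->
  P (\sum_(i < d.+1) q`_i *: (s ^+ i * t ^+ (d - i))) ->
  exists lam mu : F, (lam, mu) != (0, 0) /\ P (lam *: s - mu *: t).
Proof.
pose H e (p : {poly F}) := \sum_(i < e.+1) p`_i *: (s ^+ i * t ^+ (e - i)).
rewrite -/(H d q).
have HD e (p1 p2 : {poly F}) c : H e (p1 - c *: p2) = H e p1 - c *: H e p2.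
  rewrite /H scaler_sumr -sumrB; apply: eq_bigr => i _.
  by rewrite coefB coefZ scalerBl scalerA.
have Ht e (p : {poly F}) : p`_e.+1 = 0 -> H e.+1 p = t * H e p.
  move=> pe; rewrite /H big_ord_recr /= pe scale0r addr0 mulr_sumr.
  apply: eq_bigr => i _; rewrite subSn -1?ltnS // exprS -scalerAr; congr (_ *: _).
  by ring.
have Hs e (p : {poly F}) : H e.+1 ('X * p) = s * H e p.
  rewrite /H big_ord_recl coefXM scale0r add0r mulr_sumr.
  apply: eq_bigr => i _; rewrite coefXM /= subSS exprS -scalerAr mulrA //.
elim: d q => [|d IHd] q q0 szq PH.
  have [x x0 eqq] : exists2 x, x != 0 & q = x%:P.
    by apply/size_poly1P; rewrite eqn_leq szq lt0n size_poly_eq0.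
  move: PH; rewrite /H big_ord1 eqq coefC !expr0 mulr1 /= => PH.
  case: (prime1 _ _ primeP); rewrite -(scale1r 1) -(mulVf x0) -scalerA -mul_mpolyC.
  exact: idealMr.
(* If s^(d+1) does not occur, the form has the root at infinity: it is divisible by t = 0 s - (-1)
   t. *)
have [|ltq] := leqP (size q) d.+1.
  move=> szq'; move: PH; rewrite Ht ?nth_default // => /(primeM _ _ primeP)[Pt|PH].
    exists 0, (-1); rewrite scale0r scaleN1r opprK add0r; split=> //.
    by rewrite xpair_eqE oppr_eq0 oner_eq0 andbF.
  exact: IHd PH.
(* Otherwise [q] has degree exactly d+1, and a root [x] splits off the factor s - x t. *)
have [x /factor_theorem[p eqq]] : exists x, root q x.
  by apply: closedF; apply: contraTneq ltq => ->.
have p0 : p != 0 by apply: contraNneq q0 => p0; rewrite eqq p0 mul0r.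
have szp : (size p <= d.+1)%N by move: szq; rewrite eqq size_Mmonic ?monicXsubC // size_XsubC addn2.
have eqH : H d.+1 q = (1 *: s - x *: t) * H d p.
  rewrite eqq mulrC mulrBl mul_polyC HD Hs Ht ?nth_default //.
  by rewrite scale1r mulrBl scalerAl.
move: PH; rewrite eqH => /(primeM _ _ primeP)[Pl|PH]; last exact: IHd PH.
exists 1, x; split=> //; by rewrite xpair_eqE oner_eq0.
Qed.

End AlgebraicRelation.

(** Write f = u^(m+1) v with [u] not dividing [v]. Expanding [delta f] and cancelling u^m shows that
    [u] divides (m+1) v delta(u); being prime, it divides the last factor. *)
Lemma irred_dvd_derivation (D : idomainType) (N : D -> nat) (delta : D -> D) (u f : D) :
  size_like D N -> (forall m, m.+1%:R \is a @GRing.unit D) ->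
  (forall a b, delta (a * b) = delta a * b + a * delta b) ->
  irred D u -> prime_elt D u -> f != 0 -> dvd D u f -> dvd D f (delta f) ->
  dvd D u (delta u).
Proof.
move=> [NM NU] natU deltaM [u0 [uU _]] pr_u f0 [v0 eqf] [w eqw].
have [m [v [eqfv ndv]]] : exists m v, f = u ^+ m.+1 * v /\ ~ dvd D u v.
  have [n] := ubnP (N v0); elim: n v0 {w eqw} f f0 eqf => // n IHn v f f0 eqf leN.
  case: (classic (dvd D u v)) => [[v' eqv]|ndv]; last by exists 0%N, v; rewrite expr1.
  have v0 : v != 0 by move: f0; rewrite eqf mulf_eq0 negb_or => /andP[].
  have [|m [w [ew nw]]] := IHn v' v v0 eqv.
    rewrite -ltnS; apply: leq_trans leN; rewrite ltnS eqv NM -?eqv //.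
    by rewrite -add1n leq_add2r lt0n NU.
  by exists m.+1, w; split=> //; rewrite eqf {1}ew [in RHS]exprS mulrA.
have deltaX e : delta (u ^+ e.+1) = e.+1%:R * u ^+ e * delta u.
  elim: e => [|e IHe]; first by rewrite expr1 expr0 !mul1r.
  rewrite exprS deltaM IHe -[e.+2%:R]natr1 !exprS; ring.
have : dvd D u (m.+1%:R * v * delta u).
  exists (v * w - delta v); apply: (mulfI (expf_neq0 m u0)).
  have : delta f = u ^+ m.+1 * v * w by rewrite -eqfv.
  rewrite eqfv deltaM deltaX => e.
  have -> : u ^+ m * (u * (v * w - delta v)) =
      u ^+ m.+1 * v * w - u ^+ m.+1 * delta v by rewrite exprS; ring.
  by rewrite -e; ring.
case/pr_u => // /pr_u[] // [x ex]; case/negP: uU.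
by have := natU m; rewrite ex unitrM => /andP[].
Qed.

(** Otherwise a Bezout identity x u + y a = c would put the image of a non-zero constant [c] of R[X]
    into P. *)
Lemma irred_dvd_prime_member (R B : idomainType) (N : R -> nat)
    (phi : {rmorphism B -> {poly R}}) (psi : {rmorphism {poly R} -> B})
    (P : B -> Prop) (u a : B) :
  size_like R N -> (forall p : R, irred R p -> prime_elt R p) ->
  cancel phi psi -> prime_ideal B P -> (forall r, r != 0 -> ~ P (psi r%:P)) ->
  irred {poly R} (phi u) -> (1 < size (phi u))%N -> P u -> P a -> dvd B u a.
Proof.
move=> NR prR phiK primeP avoid irr_u szu Pu Pa.
have [[q e]|[x [y [c [c0 e]]]]] := irred_dvd_or_bezout R N NR prR _ (phi a) irr_u szu.
  by exists (psi q); rewrite -[a]phiK e rmorphM /= phiK.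
case: (avoid c c0); rewrite -e rmorphD !rmorphM /= !phiK.
by apply: (idealD B P primeP); apply: (idealMr B P primeP).
Qed.

Lemma prime_gen_by_irred (F : fieldType) n (k : 'I_n.+1)
    (P : {mpoly F[n.+1]} -> Prop) (u : {mpoly F[n.+1]}) :
  prime_ideal _ P -> (forall r, r != 0 -> ~ P (other_vars F n k r)) ->
  irred _ u -> P u -> forall a, P a <-> dvd {mpoly F[n.+1]} u a.
Proof.
move=> primeP avoid irr_u Pu a; split=> [Pa|]; last exact: (ideal_dvd _ P primeP).
have irr_u' := to_poly_irred F n k u irr_u.
apply: (irred_dvd_prime_member _ _ _ (to_poly F n k) (of_poly F n k) P u a
  (size_like_mpoly F n) (mpoly_irred_prime F n) (to_polyK F n k) primeP _ irr_u')
  => // [r r0|].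
  by rewrite /= of_polyC; apply: avoid.
(* Were [u] of degree 0 in the chosen variable, it would itself be a non-zero element of R in P. *)
rewrite ltnNge; apply/negP => /size1_polyC eqc.
have equ : u = other_vars F n k (to_poly F n k u)`_0.
  by rewrite -of_polyC -eqc to_polyK.
apply: (avoid (to_poly F n k u)`_0); last by rewrite -equ.
rewrite -(other_vars_eq0 F n k) -equ.
by have [] := irr_u.
Qed.

(** * Primes stable under derivations that extend multiples of the partial derivatives *)

Section ConstantRelations.
Variables (F : fieldType) (n : nat) (D : idomainType).
Variables (h : {rmorphism {mpoly F[n]} -> D}) (P : D -> Prop).
Variables (delta : 'I_n -> D -> D) (w : D).
Hypothesis char0 : forall m, m.+1%:R != 0 :> F.
Hypothesis primeP : prime_ideal D P.
Hypothesis deltaD : forall j a b, delta j (a + b) = delta j a + delta j b.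
Hypothesis deltaM : forall j a b, delta j (a * b) = delta j a * b + a * delta j b.
Hypothesis delta_h : forall j r, delta j (h r) = w * h (mderiv j r).
Hypothesis deltaP : forall j a, P a -> P (delta j a).
Hypothesis nPw : ~ P w.

(** By [bform_deriv] the coefficient rows of the relations in P are stable under every partial
    derivative, so [deriv_closed_const] applies to them. *)
Lemma constant_relation (s t : D) d (g : 'rV[{mpoly F[n]}]_d.+1) :
  (forall j, t * delta j s = s * delta j t) -> ~ P t -> g != 0 ->
  P (bform _ D h d g s t) ->
  exists c : 'rV[F]_d.+1, c != 0 /\ P (bform _ D (fun a => h a%:MP) d c s t).
Proof.
move=> st nPt g0 Pg; pose Q g' := P (bform _ D h d g' s t).
have Qd j g' : Q g' -> Q (map_mx (mderiv j) g').
  exact: (bform_deriv D P primeP _ h _ (delta j) s t w d g' (deltaD j)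
    (deltaM j) (delta_h j) (st j) (deltaP j) nPt nPw).
have [c [c0 Qc]] := deriv_closed_const F char0 n d.+1 Q Qd g g0 Pg.
exists c; split=> //; congr P: Qc; apply: eq_bigr => i _.
by rewrite mxE.
Qed.

(* The case s = 0, t = 1, d = 0 of the previous lemma. *)
Lemma prime_avoids_image r : r != 0 -> ~ P (h r).
Proof.
move=> r0 Pr.
have delta0 j : delta j 0 = 0.
  by have := deltaM j 0 0; rewrite !mulr0 mul0r addr0.
have delta1 j : delta j 1 = 0.
  by have := deltaM j 1 1; rewrite !mulr1 mul1r => /esym/eqP; rewrite -subr_eq0 addrK => /eqP.
have [||||c [c0]] := constant_relation 0 1 0 (const_mx r).
- by move=> j; rewrite delta0 delta1 !mulr0.
- exact: (prime1 D P primeP).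
- by apply/rV0Pn; exists 0; rewrite mxE.
- by rewrite /bform big_ord1 !expr0 !mulr1 mxE.
rewrite /bform big_ord1 !expr0 !mulr1; apply: (prime_unit D P primeP).
apply: rmorph_unit; apply: (rmorph_unit (@mpolyC n F)); rewrite unitfE.
by move: c0; apply: contra_neq => c0; apply/rowP => i; rewrite (ord1 i) c0 mxE.
Qed.

End ConstantRelations.

Lemma ord3P (i : 'I_3) : [\/ i = i0, i = i1 | i = i2].
Proof.
by case: i => [[|[|[|]]]] // ?; [constructor 1|constructor 2|constructor 3]; apply: val_inj.
Qed.

(** * The Poisson bracket *)

(* The bracket is studied over an abstract domain with three derivations:
   in A itself, unification would unfold the operations on polynomials. *)
Section Bracket.
Variables (D : idomainType) (pd : 'I_3 -> D -> D).
Hypothesis pdD : forall i a b, pd i (a + b) = pd i a + pd i b.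
Hypothesis pdM : forall i a b, pd i (a * b) = pd i a * b + a * pd i b.
Variables s t : D.

(** This is t^2 times the i-th derivative of s/t. The components 0, 1, 2 are {y,z}, {z,x}, {x,y}. *)
Definition wronsk (i : 'I_3) : D := t * pd i s - s * pd i t.

(** The triple product of grad a, grad b and [wronsk]. *)
Definition br (a b : D) : D :=
    (pd i0 a * pd i1 b - pd i1 a * pd i0 b) * wronsk i2
  + (pd i1 a * pd i2 b - pd i2 a * pd i1 b) * wronsk i0
  + (pd i2 a * pd i0 b - pd i0 a * pd i2 b) * wronsk i1.

Lemma brM (a b c : D) : br a (b * c) = br a b * c + b * br a c.
Proof. by rewrite /br !pdM; ring. Qed.

Lemma br0 a : br a 0 = 0.
Proof. by have := brM a 0 0; rewrite !mulr0 mul0r addr0. Qed.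

Lemma pdB i a b : pd i (a - b) = pd i a - pd i b.
Proof. by apply/eqP; rewrite eq_sym subr_eq -pdD subrK. Qed.

(* With f = lam s - mu t one has
   (grad f) x (t grad s - s grad t) = - f (grad s) x (grad t). *)
Lemma pencil_dvd_br (lam mu a : D) :
  (forall i, pd i lam = 0) -> (forall i, pd i mu = 0) ->
  dvd D (lam * s - mu * t) (br a (lam * s - mu * t)).
Proof.
move=> lam0 mu0.
exists (- (pd i0 a * (pd i1 s * pd i2 t - pd i2 s * pd i1 t)
         + pd i1 a * (pd i2 s * pd i0 t - pd i0 s * pd i2 t)
         + pd i2 a * (pd i0 s * pd i1 t - pd i1 s * pd i0 t))).
by rewrite /br /wronsk !pdB !pdM !lam0 !mu0; ring.
Qed.

(** Differentiating lam s = mu t gives lam [wronsk i] = 0, so lam = 0; then mu t = 0 forces mu =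
    0. *)
Lemma pencil_neq0 (lam mu : D) i :
  (forall i, pd i lam = 0) -> (forall i, pd i mu = 0) ->
  wronsk i != 0 -> t != 0 -> (lam != 0) || (mu != 0) ->
  lam * s - mu * t != 0.
Proof.
move=> lam0 mu0 wi t0 lm; apply: contraTneq lm => /eqP; rewrite subr_eq0 => /eqP e.
have lamE : lam = 0.
  have : lam * wronsk i = t * pd i (lam * s) - (lam * s) * pd i t.
    by rewrite /wronsk pdM lam0; ring.
  rewrite e pdM mu0 mul0r add0r.
  have -> : t * (mu * pd i t) - mu * t * pd i t = 0 by ring.
  by move/eqP; rewrite mulf_eq0 (negPf wi) orbF => /eqP.
move/esym/eqP: e; rewrite lamE mul0r mulf_eq0 (negPf t0) orbF => ->.
by rewrite eqxx.
Qed.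

Definition cross (k j : 'I_3) (a : D) : D :=
  wronsk k * pd j a - wronsk j * pd k a.

Lemma crossD k j a b : cross k j (a + b) = cross k j a + cross k j b.
Proof. by rewrite /cross !pdD; ring. Qed.

Lemma crossM k j a b : cross k j (a * b) = cross k j a * b + a * cross k j b.
Proof. by rewrite /cross !pdM; ring. Qed.

(** The difference of the two sides is w_k w_j - w_j w_k with w = [wronsk]. *)
Lemma cross_ratio k j : t * cross k j s = s * cross k j t.
Proof. by rewrite /cross /wronsk; ring. Qed.

Variable P : D -> Prop.
Hypothesis primeP : prime_ideal D P.

Lemma br_null : (forall i, P (wronsk i)) -> forall a b, P (br a b).
Proof.
move=> Pw a b; do 2?[apply: (idealD D P primeP)];
exact: (idealMr D P primeP).
Qed.

(* {x_i, p} is, up to sign, a component of the cross product of wronsk and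
   the gradient of p. *)
Lemma poisson_cross (x : 'I_3 -> D) :
  (forall i j, pd i (x j) = (i == j)%:R) ->
  (forall a p, P p -> P (br a p)) ->
  forall k j p, P p -> P (cross k j p).
Proof.
move=> pdx poisP k j p Pp.
have PN a : P a -> P (- a).
  by rewrite -[- a]sub0r; apply: idealB => //; apply: (ideal0 D P primeP).
have P0 := poisP (x i0) p Pp; have P1 := poisP (x i1) p Pp.
have P2 := poisP (x i2) p Pp; rewrite /br !pdx /= in P0 P1 P2.
have zero a : P (a - a) by rewrite subrr; apply: (ideal0 D P primeP).
case: (ord3P k) => ->; case: (ord3P j) => ->; rewrite /cross ?subrr.
- exact: ideal0 primeP.
- by move/PN: P2; congr P; ring.
- by move: P1; congr P; ring.
- by move: P2; congr P; ring.
- exact: ideal0 primeP.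
- by move/PN: P0; congr P; ring.
- by move/PN: P1; congr P; ring.
- by move: P0; congr P; ring.
- exact: ideal0 primeP.
Qed.

End Bracket.

(** * Specialization to A; factors of the pencil generate Poisson primes *)

Definition pd (i : 'I_3) (p : A) : A := mderiv i p.

Lemma pdD i (a b : A) : pd i (a + b) = pd i a + pd i b.
Proof. exact: mderivD. Qed.

Lemma pdM i (a b : A) : pd i (a * b) = pd i a * b + a * pd i b.
Proof. exact: mderivM. Qed.

Lemma pd_var i j : pd i 'X_j = (i == j)%:R :> A.
Proof.
by rewrite /pd; have [->|ij] := eqVneq i j; [apply: mderiv_var|apply: mderiv_var_neq].
Qed.

Lemma pd_const i (c : C) : pd i c%:MP = 0 :> A.
Proof. exact: mderivC. Qed.

Lemma pbrE (s t a b : A) : pbr s t a b = br A pd s t a b.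
Proof. by []. Qed.

Lemma pencilE (s t : A) (lam mu : C) :
  lam *: s - mu *: t = (lam%:MP : A) * s - (mu%:MP : A) * t :> A.
Proof. by rewrite -!mul_mpolyC. Qed.

Lemma pencil_combination_neq0 (s t : A) (k : 'I_3) (lam mu : C) :
  wronsk A pd s t k != 0 -> t != 0 -> (lam, mu) != (0, 0) ->
  lam *: s - mu *: t != 0.
Proof.
move=> wk t0 lm; rewrite pencilE.
refine (pencil_neq0 A pd pdM s t lam%:MP mu%:MP k (fun i => pd_const i lam)
  (fun i => pd_const i mu) wk t0 _).
have const0 (c : C) : c != 0 -> (c%:MP : A) != 0 by rewrite mpolyC_eq0.
move: lm; rewrite xpair_eqE negb_and => /orP[/const0 lam0|/const0 mu0].
  by apply/orP; left; exact lam0.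
by apply/orP; right; exact mu0.
Qed.

Lemma charC m : m.+1%:R != 0 :> C.
Proof. exact (negbT (Num.Theory.pnatr_eq0 (complex Rdefinitions.R) m.+1)). Qed.

Lemma closedC (q : {poly C}) : size q != 1%N -> exists x, root q x.
Proof. exact (elimT (@closed_rootP (complex Rdefinitions.R) q)). Qed.

Lemma natA_unit m : m.+1%:R \is a @GRing.unit A.
Proof.
have -> : m.+1%:R = (m.+1%:R)%:MP :> {mpoly C[3]} by rewrite rmorph_nat.
by apply: (rmorph_unit (@mpolyC 3 C)); rewrite unitfE charC.
Qed.

Lemma principal_is_ideal (D : idomainType) (u : D) : ideal D (dvd D u).
Proof.
split; first by exists 0; rewrite mulr0.
split=> [a b [x ->] [y ->]|a b [y ->]]; first by exists (x + y); rewrite mulrDr.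
by exists (a * y); rewrite mulrCA.
Qed.

Lemma principal_is_prime (D : idomainType) (u : D) :
  irred D u -> prime_elt D u -> prime_ideal D (dvd D u).
Proof.
move=> [_ [/negP uU _]] pr_u; split; first exact: principal_is_ideal.
split=> // -[x x1]; case: uU.
by have := unitr1 D; rewrite x1 unitrM => /andP[].
Qed.

Lemma zero_is_prime (D : idomainType) : prime_ideal D (fun a => a = 0).
Proof.
split; first by split=> //; split=> [a b -> ->|a b ->]; rewrite ?addr0 ?mulr0.
split=> [/eqP|a b /eqP]; first by rewrite oner_eq0.
by rewrite mulf_eq0 => /orP[]/eqP; [left|right].
Qed.

Lemma pencil_factor_poisson (s t : A) (lam mu : C) (u : A) :
  lam *: s - mu *: t != 0 -> irreducible_elt u ->
  divides u (lam *: s - mu *: t) -> is_poisson_prime s t (divides u).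
Proof.
rewrite pencilE => f0 irr_u uf.
have pr_u : prime_elt A u := mpoly_irred_prime C 3 u irr_u.
have primeP := principal_is_prime A u irr_u pr_u.
split; first exact primeP.
split; first exact (principal_is_ideal A u).
move=> a p [x ->]; rewrite pbrE (brM A pd pdM).
(* {a, -} is a derivation and f divides {a, f}, so its irreducible factor [u] divides {a, u}; the
   Leibniz rule then handles all multiples of [u]. *)
have uu : dvd A u (br A pd s t a u).
  apply: (irred_dvd_derivation A _ (br A pd s t a) u _ (size_like_mpoly C 3)
    natA_unit (brM A pd pdM s t a) irr_u pr_u f0 uf).
  by apply: (pencil_dvd_br A pd pdD pdM) => i; apply: pd_const.
apply: (idealD A _ primeP); first by rewrite mulrC; apply: (idealMr A _ primeP).
by exists (br A pd s t a x).
Qed.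

(** * Non-zero Poisson primes that are not residually null *)

Section NonNull.
Variables (s t : A) (P : A -> Prop) (k : 'I_3).
Hypothesis poisP : is_poisson_prime s t P.
Hypothesis nPw : ~ P (wronsk A pd s t k).

Let primeP : prime_ideal A P := proj1 poisP.
(** One derivation for each of the two variables other than x_k. *)
Let delta (j : 'I_2) : A -> A := cross A pd s t k (lift k j).

Lemma delta_other_vars j r : delta j (other_vars C 2 k r) =
  wronsk A pd s t k * (other_vars C 2 k (mderiv j r) : A).
Proof.
have red (S : pzRingType) (x y z : S) : x * y - z * 0 = x * y.
  by rewrite mulr0 subr0.
rewrite /delta /cross.
have -> : pd k (other_vars C 2 k r) = 0 by apply: mderiv_other_vars.
have -> : pd (lift k j) (other_vars C 2 k r) = other_vars C 2 k (mderiv j r).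
  exact: mderiv_lift_other_vars.
exact: red.
Qed.

Lemma delta_ideal j a : P a -> P (delta j a).
Proof.
apply: (poisson_cross A pd s t P primeP (fun i => 'X_i)) => [i l|].
  exact: pd_var.
exact: (proj2 (proj2 poisP)).
Qed.

Lemma prime_principal u : irreducible_elt u -> P u -> principal_ideal_of u P.
Proof.
move=> irr_u Pu; apply: (prime_gen_by_irred C 2 k) => //.
exact (prime_avoids_image C 2 A (other_vars C 2 k) P delta _ charC primeP
  (fun j => crossD A pd pdD s t k _) (fun j => crossM A pd pdM s t k _)
  delta_other_vars delta_ideal nPw).
Qed.

Lemma prime_contains_pencil u : u != 0 -> P u ->
  exists lam mu : C, (lam, mu) != (0, 0) /\ P (lam *: s - mu *: t).
Proof.
(* If [t] is in P it is already a member of the pencil; otherwise it may be cancelled modulo P. *)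
move=> u0 Pu; case: (classic (P t)) => [Pt|nPt].
  exists 0, (-1); rewrite scale0r scaleN1r opprK add0r; split=> //.
  by rewrite xpair_eqE oppr_eq0 oner_eq0 andbF.
have [d [g [g0 ug]]] := mpoly_relation C 2 k u s t u0.
have [||c [c0 Pc]] := constant_relation C 2 A (other_vars C 2 k) P delta _ charC primeP
    (fun j => crossD A pd pdD s t k _) (fun j => crossM A pd pdM s t k _)
    delta_other_vars delta_ideal nPw s t d g _ nPt g0.
- by move=> j; apply: cross_ratio.
- exact: (ideal_dvd A P primeP u).
(* The row [c] is read as the dehomogenized form, a polynomial in s/t. *)
apply: (bform_linear_factor C 3 P closedC primeP s t d (rVpoly c)).
- by apply: contra_neq c0 => c0; rewrite -[c]rVpolyK c0 linear0.
- exact: size_poly.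
congr P: Pc; apply: eq_bigr => i _.
rewrite coef_rVpoly_ord -mul_mpolyC; congr (_ * _).
exact: other_varsC.
Qed.

End NonNull.

Theorem theorem3p8 (s t : A) (hs : s != 0) (ht : t != 0)
    (hst : coprime_elts s t) (P : A -> Prop) :
  is_poisson_prime s t P <->
  [\/ zero_ideal P,
      is_poisson_prime s t P /\ residually_null s t P
    | exists (lam mu : C), (lam, mu) != (0, 0) /\
        let f : A := lam *: s - mu *: t in
        [/\ f != 0, f \isn't a GRing.unit &
            exists u : A, [/\ irreducible_elt u, divides u f &
                              principal_ideal_of u P]]].
Proof.
split=> [poisP|[zeroP|[]//|[lam [mu [_ [f0 _ [u [irr_u uf PE]]]]]]]]; last 2 first.
- have -> : P = (fun a => a = 0).
    by apply: functional_extensionality => a; apply: propositional_extensionality.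
  split; first exact (zero_is_prime A).
  split; first exact (proj1 (zero_is_prime A)).
  by move=> a p ->; rewrite pbrE (br0 A pd pdM).
- have -> : P = divides u.
    by apply: functional_extensionality => a; apply: propositional_extensionality.
  exact: pencil_factor_poisson f0 irr_u uf.
case: (classic (zero_ideal P)) => [|nz]; first by constructor 1.
case: (classic (residually_null s t P)) => [|nn]; first by constructor 2.
constructor 3; have primeP : prime_ideal A P := proj1 poisP.
(* If all components of [wronsk] were in P, every bracket would be. *)
have [k nPw] : exists k, ~ P (wronsk A pd s t k).
  by apply: not_all_ex_not => Pw; apply: nn; apply: (br_null A pd s t P primeP).
have wk : wronsk A pd s t k != 0.
  by apply/eqP => w0; apply: nPw; rewrite w0; apply: (ideal0 A P primeP).
have [a [a0 Pa]] : exists a, a != 0 /\ P a.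
  apply: NNPP => H; apply: nz => a; split=> [Pa|->]; last exact: (ideal0 A P primeP).
  by apply/eqP; apply: contraT => a0; case: H; exists a.
have [u [irr_u Pu]] := irred_in_prime A P primeP _ a (size_like_mpoly C 3) a0 Pa.
have PE := prime_principal s t P k poisP nPw u irr_u Pu.
have [lam [mu [nz_lm Pf]]] :=
  prime_contains_pencil s t P k poisP nPw u (proj1 irr_u) Pu.
(* The pencil member lies in the proper ideal P = uA, so it is not a unit and [u] divides it. *)
exists lam, mu; split=> //=; split.
- exact: (pencil_combination_neq0 s t k).
- by apply/negP => /(prime_unit A P primeP).
- by exists u; split=> //; apply/PE.
Qed.
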